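(* Let $k$ be a field and let $\nu$ be a real-valued monomial valuation on $k(x,y)$ such that $\nu(x)/\nu(y)=a/b$ is a positive rational number, where $a$ and $b$ are coprime integers greater than $1$, and let $p,q\in\mathbb{Z}_{>0}$ be such that $pa-qb=1$. Then the valuation ring $R_\nu$ of $\nu$ is $$R_\nu = k\left[\frac{y^{a}}{x^{b}},\frac{x^{p}}{y^{q}}\right]_{\mathfrak{p}},$$ where $\mathfrak{p}$ is the ideal of $k\left[\frac{y^{a}}{x^{b}},\frac{x^{p}}{y^{q}}\right]$ generated by $\frac{x^{p}}{y^{q}}$.
   Context: $k(x,y)$ is the field of rational functions in two variables over $k$. For $\alpha,\beta\in\mathbb{R}_{\ge 0}$, the (real-valued) monomial valuation $\nu$ on $k(x,y)$ with $\nu(x)=\alpha$, $\nu(y)=\beta$ is defined on nonzero polynomials by $\nu\left(\sum_{i,j}\lambda_{ij}x^iy^j\right)=\min\{i\alpha+j\beta : \lambda_{ij}\neq 0\}$, with $\nu(0)=\infty$, and extended to $k(x,y)$ by $\nu(f/g)=\nu(f)-\nu(g)$. The valuation ring of $\nu$ is $R_\nu=\{f\in k(x,y):\nu(f)\ge 0\}$. For a prime ideal $\mathfrak p$ of a domain $A\subset k(x,y)$, $A_{\mathfrak p}$ denotes the localization of $A$ at $\mathfrak p$, viewed as a subring of $k(x,y)$. *)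

(* Defs.v *)
From HB Require Import structures.
From mathcomp Require Import all_boot all_order all_algebra.
From mathcomp Require Import generic_quotient mpoly.
From mathcomp Require Import classical_sets reals constructive_ereal.

Set Implicit Arguments.
Unset Strict Implicit.
Unset Printing Implicit Defensive.

Import Order.TTheory GRing.Theory Num.Theory.

Local Open Scope classical_set_scope.
Local Open Scope ring_scope.
Local Open Scope quotient_scope.

(* [tofrac_mp] is the inclusion k[x, y] -> k(x, y). *)
Notation ratfun2 k := {fraction {mpoly k[2]}}.
Notation tofrac_mp k := (@FracField.tofrac {mpoly k[2]}).

Definition ratx (k : fieldType) : ratfun2 k := tofrac_mp k 'X_ord0.
Definition raty (k : fieldType) : ratfun2 k := tofrac_mp k 'X_ord_max.

Section MonomialValuation.
Variables (k : fieldType) (R : realType) (alpha beta : R).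

Definition mnm_weight (m : 'X_{1..2}) : R :=
  (m ord0)%:R * alpha + (m ord_max)%:R * beta.

(* The empty minimum, for the zero polynomial, is +oo. *)
Definition monval_poly (f : {mpoly k[2]}) : \bar R :=
  \big[Order.min/+oo%E]_(m <- msupp f) (mnm_weight m)%:E.

(* Computed on a chosen numerator and denominator (the latter nonzero);
   [monval_frac] below shows that the choice does not matter. *)
Definition monval (z : ratfun2 k) : \bar R :=
  (monval_poly \n_(repr z) - monval_poly \d_(repr z))%E.

End MonomialValuation.

Definition valuation_ring (R : realType) (F : fieldType) (nu : F -> \bar R) :
  set F := [set z | (0 <= nu z)%E].

(* k[u, v], as a subset of k(x, y). *)
Definition gen_subalg (k : fieldType) (u v : ratfun2 k) : set (ratfun2 k) :=
  range (mmap (fun c : k => tofrac_mp k c%:MP) (tnth [tuple u; v])).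

(* In the next four definitions A is meant to be a subring of F. *)
Section SubringIdeals.
Variable F : fieldType.
Implicit Types A I G : set F.

Definition is_ideal A I : Prop :=
  [/\ I `<=` A, I 0, (forall f g, I f -> I g -> I (f + g))
    & (forall c f, A c -> I f -> I (c * f))].

Definition ideal_gen A G : set F := smallest (is_ideal A) G.

Definition is_prime_ideal A I : Prop :=
  [/\ is_ideal A I, I <> A
    & (forall f g, A f -> A g -> I (f * g) -> I f \/ I g)].

Definition localization_at A I : set F :=
  [set z | exists f g, [/\ A f, A g, ~ I g & z = f / g]].

End SubringIdeals.

Section MonomialValuationTheory.
Variables (k : fieldType) (R : realType) (alpha beta : R).
Local Notation w := (mnm_weight alpha beta).
Local Notation nup := (@monval_poly k R alpha beta).
Local Notation nu := (@monval k R alpha beta).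
Implicit Types f g : {mpoly k[2]}.

Lemma mnm_weightD (m1 m2 : 'X_{1..2}) : w (m1 + m2)%MM = w m1 + w m2.
Proof. by rewrite /mnm_weight !mnmDE !natrD !mulrDl addrACA. Qed.

Lemma monval_poly0 : nup 0 = +oo%E.
Proof. by rewrite /monval_poly msupp0 big_nil. Qed.

Lemma monval_polyP f (d : R) :
  (forall m, m \in msupp f -> d <= w m) ->
  (exists2 m, m \in msupp f & w m = d) -> nup f = d%:E.
Proof.
rewrite /monval_poly; elim: (msupp f) => [_ []//|m s IHs] dle [m0 m0s wm0].
rewrite big_cons.
have dles i : i \in s -> d <= w i by move=> si; apply: dle; rewrite inE si orbT.
have dlem : d <= w m by apply: dle; rewrite inE eqxx.
move: m0s; rewrite inE => /orP[/eqP mE|m0s]; last first.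
  by rewrite IHs//; [apply/min_idPr; rewrite lee_fin|exists m0].
rewrite -mE wm0; apply/min_idPl.
elim: s dles {IHs dle} => [|i s IHs] dles; first by rewrite big_nil leey.
rewrite big_cons le_min lee_fin dles ?inE ?eqxx//=.
by apply: IHs => j js; apply: dles; rewrite inE js orbT.
Qed.

Lemma monval_poly_wit f : f != 0 -> exists2 m0, m0 \in msupp f &
  forall m, m \in msupp f -> w m0 <= w m.
Proof.
rewrite -msupp_eq0; elim: (msupp f) => [//|m s IHs] _.
have [->|/IHs[m0 m0s m0P]] := eqVneq s [::].
  by exists m; rewrite ?inE// => i; rewrite inE => /eqP->.
have [le0|/ltW le0] := leP (w m0) (w m).
  exists m0; first by rewrite inE m0s orbT.
  by move=> i; rewrite inE => /orP[/eqP->//|]; apply: m0P.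
exists m; first by rewrite inE eqxx.
move=> i; rewrite inE => /orP[/eqP->//|/m0P]; exact: le_trans.
Qed.

Lemma mcoeffM_weight0 f g (m : 'X_{1..2}) :
  (forall i j, i \in msupp f -> j \in msupp g -> w i + w j != w m) ->
  (f * g)@_m = 0.
Proof.
move=> fgm; apply/eqP; rewrite mcoeff_eq0; apply/negP => /msuppM_le.
by case/allpairsP=> -[i j] /= [fi gj mE]; move: (fgm i j fi gj);
  rewrite mE mnm_weightD eqxx.
Qed.

Lemma mpoly_split f (P : pred 'X_{1..2}) : exists f0 f1,
  [/\ f = f0 + f1, (forall m, f0@_m = if P m then f@_m else 0)
    & (forall m, f1@_m = if P m then 0 else f@_m)].
Proof.
have cE (Q : pred 'X_{1..2}) m :
    (\sum_(i <- msupp f | Q i) f@_i *: 'X_[i])@_m = if Q m then f@_m else 0.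
  rewrite [X in X@_m](_ : _ = \sum_(i <- msupp f) (if Q i then f@_i else 0) *: 'X_[i]).
    rewrite linear_sum /=.
    under eq_bigr do rewrite mcoeffZ mcoeffX.
    have [fm|fm] := boolP (m \in msupp f).
      rewrite (bigD1_seq m) ?msupp_uniq//= eqxx mulr1 big1 ?addr0// => i.
      by move=> /negbTE->; rewrite mulr0.
    rewrite big_seq big1 ?(memN_msupp_eq0 fm) ?if_same// => i fi.
    by case: eqVneq fi => [->|_ _]; [rewrite (negbTE fm)|rewrite mulr0].
  rewrite big_mkcond; apply: eq_bigr => i _.
  by case: ifP => // _; rewrite scale0r.
exists (\sum_(i <- msupp f | P i) f@_i *: 'X_[i]).
exists (\sum_(i <- msupp f | ~~ P i) f@_i *: 'X_[i]).
split=> [|m|m]; rewrite ?cE//; last by case: (P m).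
by rewrite {1}[f]mpolyE (bigID P).
Qed.

Lemma monval_polyM f g : nup (f * g) = (nup f + nup g)%E.
Proof.
have nup_neqNy h : nup h != -oo%E.
  have [->|/monval_poly_wit[m hm mP]] := eqVneq h 0; first by rewrite monval_poly0.
  by rewrite (@monval_polyP h (w m))//; exists m.
have [->|f0] := eqVneq f 0.
  by rewrite mul0r monval_poly0 addye.
have [->|g0] := eqVneq g 0.
  by rewrite mulr0 monval_poly0 addey.
have [mf fmf fP] := monval_poly_wit f0.
have [mg gmg gP] := monval_poly_wit g0.
rewrite (@monval_polyP f (w mf))//; last by exists mf.
rewrite (@monval_polyP g (w mg))//; last by exists mg.
rewrite -EFinD; apply: monval_polyP => [m /msuppM_le/allpairsP[[i j] /=]|].
  by case=> fi gj ->; rewrite mnm_weightD lerD ?fP ?gP.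
have [fa [fb [fE faE fbE]]] := mpoly_split f (fun m => w m == w mf).
have [ga [gb [gE gaE gbE]]] := mpoly_split g (fun m => w m == w mg).
have fa0 : fa != 0.
  apply: contraTneq fmf => fa_eq0; move: (faE mf).
  by rewrite fa_eq0 eqxx mcoeff0 => /esym/eqP; rewrite mcoeff_eq0.
have ga0 : ga != 0.
  apply: contraTneq gmg => ga_eq0; move: (gaE mg).
  by rewrite ga_eq0 eqxx mcoeff0 => /esym/eqP; rewrite mcoeff_eq0.
have faw i : i \in msupp fa -> w i = w mf.
  by rewrite mcoeff_msupp faE; case: (w i =P w mf) => //; rewrite eqxx.
have gaw i : i \in msupp ga -> w i = w mg.
  by rewrite mcoeff_msupp gaE; case: (w i =P w mg) => //; rewrite eqxx.
have fbw i : i \in msupp fb -> w mf < w i.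
  rewrite mcoeff_msupp fbE; case: (w i =P w mf) => [_|/eqP neq].
    by rewrite eqxx.
  by rewrite -mcoeff_msupp lt_neqAle eq_sym neq => /fP.
have gbw i : i \in msupp gb -> w mg < w i.
  rewrite mcoeff_msupp gbE; case: (w i =P w mg) => [_|/eqP neq].
    by rewrite eqxx.
  by rewrite -mcoeff_msupp lt_neqAle eq_sym neq => /gP.
have [m mfg _] := monval_poly_wit (mulf_neq0 fa0 ga0).
have wm : w m = w mf + w mg.
  have /allpairsP[[i j] /= [/faw <- /gaw <- ->]] := msuppM_le mfg.
  exact: mnm_weightD.
exists m => //; rewrite mcoeff_msupp.
have -> : f * g = fa * ga + (fa * gb + fb * g).
  by rewrite addrA -mulrDr -gE -mulrDl -fE.
rewrite !mcoeffD (@mcoeffM_weight0 fa gb)//; last first.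
  by move=> i j /faw-> /gbw wj; rewrite wm gt_eqF// ltrD2l.
rewrite (@mcoeffM_weight0 fb g)//; last first.
  by move=> i j /fbw wi /gP wj; rewrite wm gt_eqF// ltr_leD.
by rewrite !addr0 -mcoeff_msupp.
Qed.

Lemma monval_poly_fin f : f != 0 -> nup f \is a fin_num.
Proof.
by move=> /monval_poly_wit[m fm mP]; rewrite (@monval_polyP f (w m))//; exists m.
Qed.

Lemma ratfun_numden (z : ratfun2 k) :
  z = tofrac_mp k \n_(repr z) / tofrac_mp k \d_(repr z).
Proof.
set r := repr z; rewrite -[z]reprK -/r.
have d0 := denom_ratioP r.
apply: (mulIf (x := tofrac_mp k \d_r)); first by rewrite tofrac_eq0.
rewrite divfK ?tofrac_eq0//; move: {z} r d0 => r d0.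
rewrite [LHS](_ : _ = FracField.mul (\pi_{fraction {mpoly k[2]}} r) (tofrac_mp k \d_r))//.
rewrite !piE; apply/eqmodP; rewrite /= FracField.equivfE /FracField.mulf.
by rewrite !numden_Ratio ?mulf_neq0 ?oner_eq0// !mulr1 mulrC.
Qed.

Lemma monval_frac f g : g != 0 ->
  nu (tofrac_mp k f / tofrac_mp k g) = (nup f - nup g)%E.
Proof.
move=> g0; set z := _ / _; rewrite /monval.
have := ratfun_numden z; have := denom_ratioP (repr z).
set n := (frac (repr z)).1; set d := (frac (repr z)).2 => d0 zE.
have : f * d = n * g.
  apply/eqP; rewrite -(tofrac_eq (f * d)) !tofracM.
  by rewrite -eqr_div ?tofrac_eq0 // -zE.
move=> /(congr1 nup); rewrite !monval_polyM.
move: (monval_poly_fin g0) (monval_poly_fin d0).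
case: (nup g) => // b _; case: (nup d) => // c _.
case: (nup f) (nup n) => [x||] [y||]//= [] xy.
by congr (_%:E); apply/eqP; rewrite subr_eq addrAC eq_sym subr_eq xy.
Qed.

Lemma monval_tofrac f : nu (tofrac_mp k f) = nup f.
Proof.
rewrite -[tofrac_mp k f]divr1 -(@tofrac1 {mpoly k[2]}) monval_frac ?oner_eq0//.
rewrite (@monval_polyP 1 0) ?sube0// => [m|].
  by rewrite msupp1 inE => /eqP->; rewrite /mnm_weight !mnm0E !mul0r addr0.
by exists 0%MM; rewrite ?msupp1 ?inE// /mnm_weight !mnm0E !mul0r addr0.
Qed.

Lemma monval_x : nu (ratx k) = alpha%:E.
Proof.
have wx : w U_(ord0)%MM = alpha.
  by rewrite /mnm_weight !mnm1E eqxx/= mul1r mul0r addr0.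
rewrite monval_tofrac; apply: monval_polyP => [m|].
  by rewrite msuppX inE => /eqP->; rewrite wx.
by exists U_(ord0)%MM; rewrite ?msuppX ?inE.
Qed.

Lemma monval_y : nu (raty k) = beta%:E.
Proof.
have wy : w U_(ord_max)%MM = beta.
  by rewrite /mnm_weight !mnm1E eqxx/= mul1r mul0r add0r.
rewrite monval_tofrac; apply: monval_polyP => [m|].
  by rewrite msuppX inE => /eqP->; rewrite wy.
by exists U_(ord_max)%MM; rewrite ?msuppX ?inE.
Qed.

End MonomialValuationTheory.

(* Main.v *)
(** Write [nu x = a t] and [nu y = b t] with [t > 0], and let [u = y^a / x^b] and
    [v = x^p / y^q], so that [nu u = 0] and [nu v = t].  As [p a - q b = 1], the
    exponent matrix is unimodular: [x = u^q v^a] and [y = u^p v^b], hence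
    [k[x, y]] is contained in [A = k[u, v]].  Distinct monomials in [u, v] are
    distinct Laurent monomials in [x, y], so [nu] restricted to [A] is the monomial
    valuation with weights [0] and [t] in [u, v].  Thus [nu >= 0] on [A], and
    [nu f > 0] iff [v] divides [f] in [A]: the ideal generated by [v] is prime, and
    a quotient of elements of [A] with nonnegative value can be simplified by [v]
    until its denominator is outside this ideal. *)
From HB Require Import structures.
Require Import Defs.
From mathcomp Require Import all_boot all_order all_algebra.
From mathcomp Require Import mpoly.
From mathcomp Require Import classical_sets reals constructive_ereal.
From mathcomp Require Import zify.

Set Implicit Arguments.
Unset Strict Implicit.
Unset Printing Implicit Defensive.

Import Order.TTheory GRing.Theory Num.Theory.

Local Open Scope classical_set_scope.
Local Open Scope ring_scope.

(** * Monomials in two variables and substitutions on exponents *)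

Lemma prodr_ord2 (S : pzSemiRingType) (F : 'I_2 -> S) :
  \prod_(i < 2) F i = F ord0 * F ord_max.
Proof. by rewrite big_ord_recr big_ord1; congr (F _ * _); apply: val_inj. Qed.

Lemma mpolyX2 (k : fieldType) (m : 'X_{1..2}) :
  'X_[m] = 'X_ord0 ^+ m ord0 * 'X_ord_max ^+ m ord_max :> {mpoly k[2]}.
Proof. by rewrite mpolyXE_id prodr_ord2. Qed.

Lemma mnm2P (m1 m2 : 'X_{1..2}) :
  m1 ord0 = m2 ord0 -> m1 ord_max = m2 ord_max -> m1 = m2.
Proof.
move=> e0 e1; apply/mnmP => -[[|[|//]] lt_i].
  by rewrite (_ : Ordinal lt_i = ord0) //; apply: val_inj.
by rewrite (_ : Ordinal lt_i = ord_max) //; apply: val_inj.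
Qed.

Lemma mnm_le_msize n (k : nzRingType) (f : {mpoly k[n]}) m i :
  m \in msupp f -> (m i <= msize f)%N.
Proof.
move=> /msize_mdeg_lt/ltnW; apply: leq_trans.
by rewrite mdegE (bigD1 i) //= leq_addr.
Qed.

Definition mnm2 (i j : nat) : 'X_{1..2} := (U_(ord0) *+ i + U_(ord_max) *+ j)%MM.

Lemma mnm2_0 i j : mnm2 i j ord0 = i.
Proof. by rewrite mnmDE !mulmnE !mnm1E eqxx /= mul1n mul0n addn0. Qed.

Lemma mnm2_1 i j : mnm2 i j ord_max = j.
Proof. by rewrite mnmDE !mulmnE !mnm1E eqxx /= mul1n mul0n. Qed.

(** Injectivity of [h] on the support keeps distinct monomials from merging, so no coefficients add
    up or cancel. *)
Lemma mcoeff_mono_subst n n' (k : nzRingType) (f : {mpoly k[n]})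
    (h : 'X_{1..n} -> 'X_{1..n'}) m : {in msupp f &, injective h} ->
  m \in msupp f -> (\sum_(i <- msupp f) f@_i *: 'X_[h i])@_(h m) = f@_m.
Proof.
move=> injh fm; rewrite raddf_sum /= (bigD1_seq m) ?msupp_uniq //=.
rewrite mcoeffZ mcoeffX eqxx mulr1 big_seq_cond big1 ?addr0 // => i /andP[fi im].
rewrite mcoeffZ mcoeffX; case: eqP => [/injh e|_]; last by rewrite mulr0.
by rewrite e ?eqxx in im.
Qed.

Lemma msupp_mono_subst n n' (k : nzRingType) (f : {mpoly k[n]})
    (h : 'X_{1..n} -> 'X_{1..n'}) m :
  m \in msupp (\sum_(i <- msupp f) f@_i *: 'X_[h i]) ->
  exists2 i, i \in msupp f & m = h i.
Proof.
rewrite mcoeff_msupp raddf_sum /= => nz.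
have [/hasP[i fi /eqP]|/hasPn nh] := boolP (has (fun i => h i == m) (msupp f)).
  by exists i.
case/eqP: nz; rewrite big_seq big1 // => i /nh /negbTE.
by rewrite mcoeffZ mcoeffX => ->; rewrite mulr0.
Qed.

(** The support of the new polynomial is the image of the old one under [h], so every weight, and
    hence the minimum, is shifted by [d]. *)
Lemma monval_poly_mono_subst (k : fieldType) (R : realType) (al be al' be' d : R)
    (f : {mpoly k[2]}) (h : 'X_{1..2} -> 'X_{1..2}) :
  {in msupp f &, injective h} ->
  (forall m, m \in msupp f -> mnm_weight al be (h m) = mnm_weight al' be' m + d) ->
  monval_poly al be (\sum_(i <- msupp f) f@_i *: 'X_[h i])
    = (monval_poly al' be' f + d%:E)%E.
Proof.
move=> injh wh; have [->|f0] := eqVneq f 0.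
  by rewrite msupp0 big_nil !monval_poly0 addye.
have [m0 fm0 m0P] := monval_poly_wit al' be' f0.
rewrite (@monval_polyP k R al' be' f _ m0P); last by exists m0.
rewrite -EFinD; apply: monval_polyP => [m /msupp_mono_subst[i fi ->]|].
  by rewrite wh // lerD2r m0P.
exists (h m0); last exact: wh.
by rewrite mcoeff_msupp mcoeff_mono_subst // -mcoeff_msupp.
Qed.

Lemma mpolyX_neq0 (k : nzRingType) n (m : 'X_{1..n}) :
  'X_[m] != 0 :> {mpoly k[n]}.
Proof.
apply/eqP => /(congr1 (mcoeff m))/eqP.
by rewrite mcoeffX eqxx mcoeff0 oner_eq0.
Qed.

Lemma monval_polyX (k : fieldType) (R : realType) (al be : R) m :
  monval_poly al be ('X_[m] : {mpoly k[2]}) = (mnm_weight al be m)%:E.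
Proof.
apply: monval_polyP => [i|]; rewrite msuppX; first by rewrite inE => /eqP->.
by exists m; rewrite ?inE.
Qed.

Lemma monval_poly_ge0 (k : fieldType) (R : realType) (al be : R)
    (f : {mpoly k[2]}) : 0 <= al -> 0 <= be -> (0 <= monval_poly al be f)%E.
Proof.
move=> al0 be0; rewrite /monval_poly.
elim/big_ind: _ => [|c d c0 d0|m _]; first exact: leey.
  by rewrite le_min c0.
by rewrite lee_fin addr_ge0 // mulr_ge0.
Qed.

Lemma monvalM (k : fieldType) (R : realType) (al be : R) (z1 z2 : ratfun2 k) :
  monval al be (z1 * z2) = (monval al be z1 + monval al be z2)%E.
Proof.
rewrite {1}(ratfun_numden z1) {1}(ratfun_numden z2) mulf_div.
rewrite -!(rmorphM (tofrac_mp k)) monval_frac ?mulf_neq0 ?denom_ratioP //.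
by rewrite !monval_polyM fin_num_oppeD ?monval_poly_fin ?denom_ratioP // addeACA.
Qed.

Lemma msuppX_dvd (k : fieldType) (f : {mpoly k[2]}) i :
  (forall m, m \in msupp f -> (0 < m i)%N) -> exists g, f = 'X_i * g.
Proof.
move=> fP; exists (\sum_(m <- msupp f) f@_m *: 'X_[m - U_(i)]).
rewrite {1}[f]mpolyE mulr_sumr big_seq [RHS]big_seq.
apply: eq_bigr => m fm; rewrite -scalerAr -mpolyXD addmC submK //.
apply/mnm_lepP => j; rewrite mnm1E; case: eqVneq => // <-; exact: fP.
Qed.

Lemma msize_mulX (k : fieldType) n (g : {mpoly k[n]}) i :
  g != 0 -> msize ('X_i * g) = (msize g).+1.
Proof.
move=> g0; by rewrite msizeM ?mpolyX_neq0 // msizeX mdeg1.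
Qed.

(** The bounds by [N] make the truncated subtractions exact, so one denominator serves all
    monomials. *)
Lemma clear_denominators (F : fieldType) (x y : F) a b p q N i j :
    x != 0 -> y != 0 -> (i <= N)%N -> (j <= N)%N ->
  (y ^+ a / x ^+ b) ^+ i * (x ^+ p / y ^+ q) ^+ j =
  x ^+ (b * (N - i) + p * j) * y ^+ (q * (N - j) + a * i)
    / (x ^+ (b * N) * y ^+ (q * N)).
Proof.
move=> x0 y0 le0 le1; rewrite !expr_div_n -!exprM mulf_div.
apply/eqP; rewrite eqr_div ?mulf_neq0 ?expf_neq0 // (mulrC (y ^+ _)).
rewrite ![_ * (x ^+ _ * _)]mulrACA -!exprD.
by apply/eqP; congr (_ ^+ _ * _ ^+ _); nia.
Qed.

(** * Recovering x and y from u and v *)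

Section Unimodular.
Variables (F : fieldType) (x y : F) (a b p q : nat).
Hypotheses (x0 : x != 0) (y0 : y != 0) (pqE : (p * a = (q * b).+1)%N).

Lemma unimodular_x : (y ^+ a / x ^+ b) ^+ q * (x ^+ p / y ^+ q) ^+ a = x.
Proof.
rewrite !expr_div_n -!exprM mulf_div pqE (mulnC a q) (mulnC b q).
by rewrite exprS (mulrC (y ^+ _)) -(mulrA x) mulfK ?mulf_neq0 ?expf_neq0.
Qed.

Lemma unimodular_y : (y ^+ a / x ^+ b) ^+ p * (x ^+ p / y ^+ q) ^+ b = y.
Proof.
rewrite !expr_div_n -!exprM mulf_div (mulnC a p) pqE (mulnC b p).
by rewrite exprS -(mulrA y) (mulrC (y ^+ _)) mulfK ?mulf_neq0 ?expf_neq0.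
Qed.

End Unimodular.

(** * The valuation on k[u, v] *)

Section MonomialChange.
Variables (k : fieldType) (R : realType) (t : R) (a b p q : nat).
Hypothesis t_gt0 : 0 < t.
Hypothesis pqE : (p * a = (q * b).+1)%N.

Let F := ratfun2 k.
Let x : F := ratx k.
Let y : F := raty k.
Let u : F := y ^+ a / x ^+ b.
Let v : F := x ^+ p / y ^+ q.
Let al := a%:R * t.
Let be := b%:R * t.
Let nu := @monval k R al be.
Let A := gen_subalg u v.

(** Convertible to the map whose range is [A]; the coefficient map is written as a composition so
    that the ring morphism structure is inferred. *)
Definition subst_uv : {mpoly k[2]} -> F :=
  mmap (tofrac_mp k \o @mpolyC 2 k) (tnth [tuple u; v]).
HB.instance Definition _ := GRing.RMorphism.on subst_uv.

Lemma x_neq0 : x != 0.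
Proof. by rewrite /x tofrac_eq0 mpolyX_neq0. Qed.

Lemma y_neq0 : y != 0.
Proof. by rewrite /y tofrac_eq0 mpolyX_neq0. Qed.

Lemma tofracX m : tofrac_mp k 'X_[m] = x ^+ m ord0 * y ^+ m ord_max.
Proof.
by rewrite mpolyX2 (rmorphM (tofrac_mp k)) !(rmorphXn (tofrac_mp k)).
Qed.

Lemma v_neq0 : v != 0.
Proof.
exact: mulf_neq0 (expf_neq0 p x_neq0) (invr_neq0 (expf_neq0 q y_neq0)).
Qed.

Lemma subst_uvX m : subst_uv 'X_[m] = u ^+ m ord0 * v ^+ m ord_max.
Proof. by rewrite /subst_uv mmapX /mmap1 prodr_ord2. Qed.

Lemma subst_uv_Xmax : subst_uv 'X_ord_max = v.
Proof. by rewrite subst_uvX !mnm1E eqxx /= mul1r. Qed.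

Lemma subst_uv_mulXmax f : subst_uv ('X_ord_max * f) = v * subst_uv f.
Proof. by rewrite (rmorphM subst_uv) [X in X * _]subst_uv_Xmax. Qed.

Lemma subst_uvZ c f : subst_uv (c *: f) = tofrac_mp k c%:MP * subst_uv f.
Proof. exact: mmapZ. Qed.

(* [x ^+ (b * N) * y ^+ (q * N)] is a common denominator of the monomials
   [u ^+ i * v ^+ j] with [i, j <= N]; [clear_mnm N] is the exponent of the
   resulting numerator. *)
Let clear_mnm N (m : 'X_{1..2}) : 'X_{1..2} :=
  mnm2 (b * (N - m ord0) + p * m ord_max) (q * (N - m ord_max) + a * m ord0).

(** In units of [t], the terms in [m ord0] cancel ([- a * b + b * a]), while [m ord_max] gets the
    coefficient [p * a - q * b = 1]. *)
Lemma clear_mnm_weight N (m : 'X_{1..2}) : (m ord0 <= N)%N -> (m ord_max <= N)%N ->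
  mnm_weight al be (clear_mnm N m) =
  mnm_weight 0 t m + (b * N)%:R * al + (q * N)%:R * be.
Proof.
move=> le0 le1; rewrite /mnm_weight mnm2_0 mnm2_1 /al /be mulr0 add0r.
rewrite !mulrA -mulrDl -!natrM -mulrDl -natrD -!mulrDl -!natrD.
congr (_%:R * _); move: (m ord0) (m ord_max) le0 le1 => i j le0 le1.
have pqj : (p * a * j = (q * b).+1 * j)%N by rewrite pqE.
(* Introducing the differences [c] and [d] removes truncated subtraction and leaves a polynomial
   identity. *)
have [c cE] : exists c, (N = c + i)%N by exists (N - i)%N; rewrite subnK.
have [d dE] : exists d, (N = d + j)%N by exists (N - j)%N; rewrite subnK.
rewrite {1 3}cE {1}dE !addnK {1}dE; nia.
Qed.

(** The weight determines [m ord_max] because [t] is nonzero; the exponent of y then determines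
    [m ord0]. *)
Lemma clear_mnm_inj N (m1 m2 : 'X_{1..2}) :
  (m1 ord0 <= N)%N -> (m1 ord_max <= N)%N ->
  (m2 ord0 <= N)%N -> (m2 ord_max <= N)%N ->
  clear_mnm N m1 = clear_mnm N m2 -> m1 = m2.
Proof.
move=> le10 le11 le20 le21 e.
have [m1E m2E] := (clear_mnm_weight le10 le11, clear_mnm_weight le20 le21).
have e1 : m1 ord_max = m2 ord_max.
  move: m1E; rewrite e m2E => /addIr/addIr/eqP.
  rewrite /mnm_weight !mulr0 !add0r.
  by rewrite (inj_eq (mulIf (lt0r_neq0 t_gt0))) eqr_nat => /eqP.
apply: mnm2P => //; move: (congr1 (fun m : 'X_{1..2} => m ord_max) e).
rewrite /clear_mnm !mnm2_1 e1 => /addnI/eqP.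
(* [a] is positive because [p * a] is a successor. *)
by rewrite eqn_pmul2l => [/eqP //|]; move: pqE; lia.
Qed.

Lemma subst_uvE N f : (msize f <= N)%N -> subst_uv f =
  tofrac_mp k (\sum_(m <- msupp f) f@_m *: 'X_[clear_mnm N m])
    / tofrac_mp k 'X_[mnm2 (b * N) (q * N)].
Proof.
move=> fN; rewrite [X in subst_uv X]mpolyE raddf_sum /= raddf_sum /= mulr_suml.
rewrite big_seq [RHS]big_seq; apply: eq_bigr => m fm.
have le0 := leq_trans (mnm_le_msize ord0 fm) fN.
have le1 := leq_trans (mnm_le_msize ord_max fm) fN.
rewrite subst_uvZ subst_uvX -mul_mpolyC (rmorphM (tofrac_mp k)) -[RHS]mulrA.
congr (_ * _); rewrite /= tofracX [tofrac_mp k 'X_[clear_mnm N m]]tofracX !mnm2_0 !mnm2_1.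
exact: (clear_denominators _ _ _ _ x_neq0 y_neq0).
Qed.

Lemma monval_subst_uv f : nu (subst_uv f) = monval_poly 0 t f.
Proof.
rewrite (@subst_uvE (msize f)) // /nu monval_frac ?mpolyX_neq0 //.
(* [d] is the value of the common denominator, which the quotient subtracts again. *)
pose d : R := (b * msize f)%:R * al + (q * msize f)%:R * be.
rewrite (@monval_poly_mono_subst _ _ _ _ 0 t d); first last.
- by move=> m fm; rewrite clear_mnm_weight ?mnm_le_msize // -addrA.
- by move=> m1 m2 fm1 fm2; apply: clear_mnm_inj; exact: mnm_le_msize.
by rewrite monval_polyX /mnm_weight mnm2_0 mnm2_1 addeK.
Qed.

(** This is the inclusion of k[x, y] in k[u, v]: the witness substitutes u^q v^a for x and u^p v^b
    for y. *)
Lemma tofrac_subst_uv f : exists g, tofrac_mp k f = subst_uv g.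
Proof.
have xE : subst_uv 'X_[mnm2 q a] = x.
  by rewrite subst_uvX mnm2_0 mnm2_1; exact: unimodular_x x_neq0 y_neq0 pqE.
have yE : subst_uv 'X_[mnm2 p b] = y.
  by rewrite subst_uvX mnm2_0 mnm2_1; exact: unimodular_y x_neq0 y_neq0 pqE.
exists (f \mPo [tuple 'X_[mnm2 q a]; 'X_[mnm2 p b]]).
rewrite comp_mpolyE {1}[f]mpolyE !raddf_sum; apply: eq_bigr => m _ /=.
rewrite -mul_mpolyC (rmorphM (tofrac_mp k)).
rewrite [X in _ * X = _]tofracX [RHS]subst_uvZ.
by rewrite prodr_ord2 (rmorphM subst_uv) !(rmorphXn subst_uv) -xE -yE.
Qed.

Lemma monval_subst_uv_gt0 f : (0 < nu (subst_uv f))%E ->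
  exists g, f = 'X_ord_max * g.
Proof.
rewrite monval_subst_uv => f_gt0; apply: msuppX_dvd => m fm.
(* A monomial without v has weight 0, so the minimum could not be positive. *)
case: posnP => // m0; move: f_gt0; rewrite ltNge => /negP[].
rewrite /monval_poly (big_rem m) //= ge_min.
by rewrite /mnm_weight m0 mulr0 mul0r addr0 lexx.
Qed.

(** * The ideal generated by v and the localization at it *)

Lemma is_ideal_v : is_ideal A [set subst_uv ('X_ord_max * g) | g in setT].
Proof.
split=> [_ [g _ <-]| |_ _ [f _ <-] [g _ <-]|_ _ [c _ <-] [f _ <-]].
- by exists ('X_ord_max * g).
- by exists 0; rewrite // mulr0 (rmorph0 subst_uv).
- by exists (f + g); rewrite // mulrDr (rmorphD subst_uv).
- by exists (c * f); rewrite // mulrCA (rmorphM subst_uv).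
Qed.

Lemma ideal_gen_vE :
  ideal_gen A [set v] = [set subst_uv ('X_ord_max * g) | g in setT].
Proof.
apply/seteqP; split=> [z|_ [g _ <-] I [[IA I0 ID IM] Iv]].
  apply; split=> [|_ ->]; first exact: is_ideal_v.
  by exists 1; rewrite // subst_uv_mulXmax (rmorph1 subst_uv) mulr1.
rewrite subst_uv_mulXmax mulrC; apply: IM; first by exists g.
exact: Iv.
Qed.

Lemma monval_subst_uv_ge0 f : (0 <= nu (subst_uv f))%E.
Proof.
rewrite monval_subst_uv; apply: monval_poly_ge0 => //; exact: ltW.
Qed.

Lemma ideal_gen_vP f :
  ideal_gen A [set v] (subst_uv f) <-> (0 < nu (subst_uv f))%E.
Proof.
rewrite ideal_gen_vE; split=> [[g _ <-]|/monval_subst_uv_gt0[g ->]]; last by exists g.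
rewrite monval_subst_uv monval_polyM monval_polyX.
rewrite /mnm_weight !mnm1E eqxx /= mul0r add0r mul1r.
move: (monval_subst_uv_ge0 g); rewrite monval_subst_uv.
case: monval_poly => // r; rewrite -EFinD lee_fin lte_fin => r_ge0.
exact: ltr_wpDr.
Qed.

Lemma ideal_gen_vPn f :
  ~ ideal_gen A [set v] (subst_uv f) <-> nu (subst_uv f) = 0%E.
Proof.
rewrite ideal_gen_vP; split=> [/negP|->]; last by rewrite ltxx.
by rewrite -leNgt => f_le0; apply/eqP; rewrite eq_le f_le0 monval_subst_uv_ge0.
Qed.

Lemma is_prime_ideal_gen_v : is_prime_ideal A (ideal_gen A [set v]).
Proof.
split=> [|PA|_ _ [f _ <-] [g _ <-]].
- by rewrite ideal_gen_vE; exact: is_ideal_v.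
- have : A (subst_uv 1) by exists 1.
  rewrite -PA => /ideal_gen_vP; rewrite monval_subst_uv -mpolyX0 monval_polyX.
  by rewrite /mnm_weight !mnm0E !mul0r addr0 ltxx.
change (ideal_gen A [set v] (subst_uv f * subst_uv g) ->
  ideal_gen A [set v] (subst_uv f) \/ ideal_gen A [set v] (subst_uv g)).
rewrite -(rmorphM subst_uv) !ideal_gen_vP !monval_subst_uv monval_polyM.
(* By contraposition: two nonpositive values have a nonpositive sum. *)
rewrite -!monval_subst_uv => fg_gt0; apply/orP; apply/contraLR: fg_gt0.
rewrite negb_or -!leNgt => /andP[f_le0 g_le0]; exact: adde_le0.
Qed.

(** Induction on the size of [g]: if its value is positive, v divides both [f] and [g], and
    cancelling it lowers the size by one. *)
Lemma frac_mem_localization (f g : {mpoly k[2]}) : g != 0 ->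
  (nu (subst_uv g) <= nu (subst_uv f))%E ->
  localization_at A (ideal_gen A [set v]) (subst_uv f / subst_uv g).
Proof.
have [n] := ubnP (msize g); elim: n => // n IHn in f g * => gn g0 le_gf.
have [g_gt0|g_le0] := ltP 0%E (nu (subst_uv g)); last first.
  exists (subst_uv f), (subst_uv g); split; [by exists f|by exists g| |by []].
  by move/ideal_gen_vP; rewrite ltNge g_le0.
have [f' fE] := monval_subst_uv_gt0 (lt_le_trans g_gt0 le_gf).
have [g' gE] := monval_subst_uv_gt0 g_gt0.
move: gn g0 le_gf; rewrite fE gE mulf_eq0 negb_or => gn /andP[_ g'0].
(* The value of v is finite, so it cancels from both sides of the inequality. *)
rewrite !monval_subst_uv !monval_polyM !monval_polyX leeD2lE // => le_gf.
rewrite !subst_uv_mulXmax -mulf_div (divff v_neq0) mul1r.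
apply: IHn => //; last by rewrite !monval_subst_uv.
by rewrite msize_mulX in gn.
Qed.

Lemma valuation_ring_v :
  valuation_ring nu = localization_at A (ideal_gen A [set v]).
Proof.
apply/seteqP; split=> [z|_ [_ [_ [[f _ <-] [g _ <-] gP ->]]]].
  (* The numerator and denominator of [z] in k[x, y] are rewritten as elements of k[u, v]. *)
  have d0 := denom_ratioP (repr z).
  have [[f fE] [g gE]] := (tofrac_subst_uv \n_(repr z), tofrac_subst_uv \d_(repr z)).
  rewrite /valuation_ring /= /nu /monval sube_ge0; last by rewrite monval_poly_fin.
  rewrite -!monval_tofrac fE gE => le_gf; rewrite (ratfun_numden z) fE gE.
  apply: frac_mem_localization => //; apply: contraNneq d0 => g0.
  by rewrite -tofrac_eq0 gE g0 (rmorph0 subst_uv).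
rewrite /valuation_ring /=; change (0 <= nu (subst_uv f / subst_uv g)%R)%E.
have /ideal_gen_vPn nug := gP.
have g0 : subst_uv g != 0.
  (* Zero has value [+oo], whereas [g] has value 0. *)
  apply/eqP => g0; move: nug; rewrite g0 -(rmorph0 subst_uv) monval_subst_uv.
  by rewrite monval_poly0.
have nuE : nu (subst_uv f) = (nu (subst_uv f / subst_uv g)%R + nu (subst_uv g))%E.
  rewrite -[in LHS](divfK g0 (subst_uv f)); exact: monvalM.
by have := monval_subst_uv_ge0 f; rewrite nuE nug adde0.
Qed.

End MonomialChange.

Theorem theorem3p10 (k : fieldType) (R : realType) (alpha beta : R)
    (alpha_ge0 : 0 <= alpha) (beta_ge0 : 0 <= beta)
    (a b : nat) (a_gt1 : (1 < a)%N) (b_gt1 : (1 < b)%N) (coab : coprime a b)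
    (ratio_ab : alpha / beta = a%:R / b%:R)
    (p q : nat) (p_gt0 : (0 < p)%N) (q_gt0 : (0 < q)%N)
    (pq_ab : p%:Z * a%:Z - q%:Z * b%:Z = 1) :
  let nu : ratfun2 k -> \bar R := monval alpha beta in
  let u := raty k ^+ a / ratx k ^+ b in
  let v := ratx k ^+ p / raty k ^+ q in
  let A := gen_subalg u v in
  let P := ideal_gen A [set v] in
  is_prime_ideal A P /\ valuation_ring nu = localization_at A P.
Proof.
move=> nu u v A P.
have pqE : (p * a = (q * b).+1)%N by lia.
have a0 : (a%:R : R) != 0 by rewrite pnatr_eq0; lia.
have b0 : (b%:R : R) != 0 by rewrite pnatr_eq0; lia.
have beta0 : beta != 0.
  (* With the convention [0^-1 = 0], a zero [beta] would make the ratio 0, but [a / b] is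
     nonzero. *)
  apply/eqP => e; move: ratio_ab; rewrite e invr0 mulr0 => /esym/eqP.
  by rewrite mulf_eq0 invr_eq0 (negbTE a0) (negbTE b0).
(* The common unit [t] is [beta / b], in which the weights are [a * t] and [b * t]. *)
have t_gt0 : 0 < beta / b%:R by rewrite divr_gt0 ?ltr0n ?lt0r ?beta0 //; lia.
have betaE : beta = b%:R * (beta / b%:R) by rewrite mulrC divfK.
have alphaE : alpha = a%:R * (beta / b%:R).
  by rewrite mulrCA -ratio_ab mulrC divfK.
have -> : nu = monval (a%:R * (beta / b%:R)) (b%:R * (beta / b%:R)).
  by rewrite /nu -alphaE -betaE.
split; first exact: (is_prime_ideal_gen_v k t_gt0 pqE).
exact: (valuation_ring_v k t_gt0 pqE).
Qed.
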